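(* Let $\alpha\in[0,1]$, let $F_s\neq F_b$ be absolutely continuous CDFs on $\mathbb{R}$ with densities $f_s$ and $f_b$ respectively, let $F=\alpha F_s+(1-\alpha)F_b$, and let $\alpha_0:=\inf\{\gamma\in(0,1]: [F-(1-\gamma)F_b]/\gamma \text{ is a CDF}\}$. Then $$\alpha_0=\alpha\left\{1-\operatorname{ess\,inf}\frac{f_s}{f_b}\right\}.$$ As a consequence, $\alpha_0<\alpha$ if and only if there exists $c>0$ such that $f_s\ge c f_b$ almost everywhere with respect to Lebesgue measure.
   Context: For a function $g$, $\operatorname{ess\,inf} g=\sup\{a\in\mathbb{R}:\mathfrak{m}(\{x:g(x)<a\})=0\}$, where $\mathfrak{m}$ is Lebesgue measure. In the quotient $f_s/f_b$ the convention $0/0=1$ is used.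
   Formalization: The equivalence ''α₀<α iff some c>0 has f_s ≥ c f_b a.e.'' is stated only for α>0; at α=0 it is false, since α₀=α=0 while such c can exist (F_b uniform on [0,1], f_s(x)=1/2+x on [0,1], c=1/2). *)

(* Defs.v *)
From HB Require Import structures.
From mathcomp Require Import all_boot all_order all_algebra.
From mathcomp Require Import all_classical all_reals all_analysis measurable_realfun ess_sup_inf.
Set Implicit Arguments.
Unset Strict Implicit.
Unset Printing Implicit Defensive.
Import Order.TTheory GRing.Theory Num.Theory numFieldNormedType.Exports.
Local Open Scope classical_set_scope.
Local Open Scope ring_scope.

Definition is_cdf {R : realType} (F : R -> R) : Prop :=
  [/\ nondecreasing F, right_continuous F, F @ -oo --> (0 : R) & F @ +oo --> (1 : R)].

Lemma is_cdfP (R : realType) (F : R -> R) :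
  is_cdf F <-> exists G : cumulativeBounded (0 : R) (1 : R), F = G :> (R -> R).
Proof.
split=> [[Fnd Frc F0 F1]|[G ->]]; last first.
  by split; [exact: cumulative_is_nondecreasing
    | exact: cumulative_is_right_continuous | exact: cumulativeNy
    | exact: cumulativey].
pose m1 := isCumulative.Build R _ R F Fnd Frc.
pose m2 := isCumulativeBounded.Build R 0 1 F F0 F1.
pose G : cumulativeBounded (0 : R) (1 : R) := HB.pack F m1 m2.
by exists G.
Qed.

(* A CDF is absolutely continuous exactly when it has such an f. *)
Definition is_density {R : realType} (F f : R -> R) : Prop :=
  [/\ measurable_fun [set: R] f, forall x, 0 <= f x &
      forall x, (\int[lebesgue_measure]_(t in `]-oo, x]) (f t)%:E = (F x)%:E)%E].

(* The quotient f / g of nonnegative functions with 0 / 0 = 1. Division in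
   \bar R gives a / 0 = +oo for a > 0. *)
Definition quotient01 {R : realType} (f g : R -> R) (x : R) : \bar R :=
  (if (f x == 0%R) && (g x == 0%R) then 1 else (f x)%:E / (g x)%:E)%E.

Definition alpha0 {R : realType} (F Fb : R -> R) : R :=
  inf [set gamma : R | 0 < gamma <= 1 /\
         is_cdf (fun x => (F x - (1 - gamma) * Fb x) / gamma)].

Lemma ess_inf_realE (R : realType) (g : R -> \bar R) :
  measurable_fun [set: R] g ->
  ess_inf lebesgue_measure g =
  ereal_sup [set a%:E | a in
    [set a : R | lebesgue_measure [set x | (g x < a%:E)%E] = 0%E]].
Proof.
move=> mg.
have aeP (a : R) : (\forall x \ae lebesgue_measure, (a%:E <= g x)%E) <->
    lebesgue_measure [set x | (g x < a%:E)%E] = 0%E.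
  have mN : measurable [set x | (g x < a%:E)%E].
    by rewrite -[X in measurable X]setTI; exact: emeasurable_fun_infty_o.
  have eqN : ~` [set x | (a%:E <= g x)%E] = [set x | (g x < a%:E)%E].
    by apply/seteqP; split => x /=; rewrite ltNge => /negP.
  by rewrite -negligibleP// -eqN.
apply/eqP; rewrite eq_le; apply/andP; split; last first.
  by apply: ge_ereal_sup => _ [a /aeP ga <-]; exact/ess_infP.
have le_sup (a : R) : (a%:E <= ess_inf lebesgue_measure g)%E ->
    (a%:E <= ereal_sup [set b%:E | b in
      [set b : R | lebesgue_measure [set x | (g x < b%:E)%E] = 0%E]])%E.
  by move=> /ess_infP /aeP ga; apply: ereal_sup_ubound; exists a.
move: le_sup; case: (ess_inf lebesgue_measure g) => [r|le_sup|_]; [exact| |by rewrite leNye].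
by rewrite leye_eq; apply/eqP/eqyP => a _; apply: le_sup; rewrite leey.
Qed.

(* Main.v *)
(* Dividing out gamma, the function [F - (1 - gamma) Fb] / gamma is the affine
   combination a Fs + (1 - a) Fb with a = alpha / gamma, which is a CDF as soon
   as it is nondecreasing.  By Lebesgue differentiation, for a > 0 this means
   fs >= (1 - 1 / a) fb almost everywhere, i.e. a (1 - ess inf fs / fb) <= 1.
   So alpha0 is the infimum of the gamma in ]0, 1] that are at least
   alpha (1 - ess inf fs / fb). *)
Require Import Defs.
From HB Require Import structures.
From mathcomp Require Import all_boot all_order all_algebra.
From mathcomp Require Import all_classical all_reals all_analysis ess_sup_inf.
From mathcomp Require Import measurable_realfun ring.
Set Implicit Arguments.
Unset Strict Implicit.
Unset Printing Implicit Defensive.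
Import Order.TTheory GRing.Theory Num.Theory numFieldNormedType.Exports.
Local Open Scope classical_set_scope.
Local Open Scope ring_scope.

Lemma nondecreasing_derive1_ge0 (R : realType) (f : R -> R) (x : R) :
  nondecreasing f -> derivable f x 1 -> 0 <= derive1 f x.
Proof.
move=> ndf; rewrite derive1E => df; apply: limr_ge => //.
near=> h; rewrite /= [h *: 1]mulr1.
have [h0|h0|h0] := ltgtP h 0.
- by apply: mulr_le0; [rewrite invr_le0 ltW|rewrite subr_le0 ndf// gerDr ltW].
- by apply: mulr_ge0; [rewrite invr_ge0 ltW|rewrite subr_ge0 ndf// lerDr ltW].
(* The value [h = 0] needs no exclusion: with [0^-1 = 0] the quotient there is 0. *)
- by rewrite h0 invr0 scale0r.
Unshelve. all: by end_near. Qed.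

(* The library hint for ae filters does not fire on lebesgue_measure. *)
#[local] Instance ae_lebesgue_filter (R : realType) :
  Filter (nbhs (almost_everywhere (@lebesgue_measure R))).
Proof. exact: (ae_filter_ringOfSetsType lebesgue_measure). Qed.

(** By Lebesgue differentiation [f] is almost everywhere the derivative of its primitive, so
    monotonicity gives the sign. Conversely, each increment of the primitive is the integral of [f]
    over []x, y]]. *)
Lemma nondecreasing_integral_ge0 (R : realType) (f : R -> R) :
  measurable_fun [set: R] f ->
  (forall x, lebesgue_measure.-integrable `]-oo, x] (EFin \o f)) ->
  nondecreasing (fun x => \int[lebesgue_measure]_(t in `]-oo, x]) f t) <->
  \forall x \ae lebesgue_measure, 0 <= f x.
Proof.
move=> mf intf; split=> [ndF|f0].
  have locf : locally_integrable [set: R] f.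
    split; [exact: mf|exact: openT|move=> K _ cK].
    (* A compact set is bounded, hence lies in a left ray, where [f] is integrable. *)
    have [M [_ KM]] := compact_bounded cK.
    have KMy : K `<=` `]-oo, (M + 1)].
      move=> x Kx; rewrite /= in_itv/=.
      by apply: le_trans (ler_norm _) _; apply: (KM (M + 1)) => //; rewrite ltrDl.
    have /integrableP[_] : lebesgue_measure.-integrable K (EFin \o f).
      apply: integrableS (intf (M + 1)) => //.
      by apply: compact_measurable.
    by [].
  apply: filterS (FTC1Ny intf locf) => x [dF <-].
  exact: nondecreasing_derive1_ge0.
move=> x y xy; rewrite -subr_ge0 Rintegral_itvB//.
(* The sign of [f] is known only almost everywhere; its absolute value has the same integral and is
   nonnegative everywhere. *)
rewrite /Rintegral; have -> : (\int[lebesgue_measure]_(t in `]x, y]) (f t)%:E =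
    \int[lebesgue_measure]_(t in `]x, y]) `|(f t)%:E|)%E.
  apply: ae_eq_integral => //.
  - by apply/measurable_EFinP; exact: measurable_funTS.
  - by apply: measurableT_comp => //; apply/measurable_EFinP; exact: measurable_funTS.
  - by apply: filterS f0 => t ft _; rewrite /= ger0_norm.
by apply: fine_ge0; exact: integral_ge0.
Qed.

Section density.
Variable R : realType.
Implicit Types (F f : R -> R) (c : R).

Lemma density_integrable F f : is_density F f ->
  forall x, lebesgue_measure.-integrable `]-oo, x] (EFin \o f).
Proof.
move=> [mf f0 intf] x; apply/integrableP; split.
  by apply/measurable_EFinP; exact: measurable_funTS.
under eq_integral do rewrite /= ger0_norm//.
by rewrite intf ltry.
Qed.

(** Linearity of the integral makes [F1 - c * F2] the primitive of [f1 - c * f2], for [c] of either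
    sign. *)
Lemma nondecreasing_density F1 F2 f1 f2 c :
  is_density F1 f1 -> is_density F2 f2 ->
  nondecreasing (fun x => F1 x - c * F2 x) <->
  \forall x \ae lebesgue_measure, c * f2 x <= f1 x.
Proof.
move=> d1 d2.
have i1 := density_integrable d1; have i2 := density_integrable d2.
have ic2 x : lebesgue_measure.-integrable `]-oo, x] (EFin \o (fun t => c * f2 t)).
  exact: (integrableZl _ c (i2 x)).
have [mf1 _ F1E] := d1; have [mf2 _ F2E] := d2.
have -> : (fun x => F1 x - c * F2 x) =
    (fun x => \int[lebesgue_measure]_(t in `]-oo, x]) (f1 t - c * f2 t)).
  apply/funext => x; rewrite RintegralB// RintegralZl//.
  by rewrite /Rintegral F1E F2E.
rewrite nondecreasing_integral_ge0; last 2 first.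
- by apply: measurable_funB => //; exact: measurable_funM.
- by move=> x; exact: (integrableB _ (i1 x) (ic2 x)).
by split; apply: filterS => x; rewrite subr_ge0.
Qed.

Lemma quotient01_ge_mul f g x c : 0 <= f x -> 0 <= g x ->
  (c%:E <= quotient01 f g x)%E -> c * g x <= f x.
Proof.
move=> fx0 gx0; have [->|gN0] := eqVneq (g x) 0; first by rewrite mulr0.
have gx : 0 < g x by rewrite lt_neqAle eq_sym gN0.
by rewrite /quotient01 (negbTE gN0) andbF inver (negbTE gN0) lee_pdivlMr.
Qed.

(* For c > 1 the equivalence fails where f and g both vanish, since 0 / 0 = 1. *)
Lemma le_quotient01 f g x c : 0 <= f x -> 0 <= g x -> c <= 1 ->
  (c%:E <= quotient01 f g x)%E = (c * g x <= f x).
Proof.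
move=> fx0 gx0 c1; apply/idP/idP; first exact: quotient01_ge_mul.
rewrite /quotient01; have [g0|gN0] := eqVneq (g x) 0; last first.
  have gx : 0 < g x by rewrite lt_neqAle eq_sym gN0.
  by rewrite andbF inver (negbTE gN0) lee_pdivlMr.
move=> _; have [_|fN0] /= := eqVneq (f x) 0; first by rewrite lee_fin.
by rewrite g0 inve0 gt0_muley ?leey// lte_fin lt_neqAle eq_sym fN0.
Qed.

Variables (Fs Fb fs fb : R -> R).
Hypotheses (hFs : is_cdf Fs) (hFb : is_cdf Fb).
Hypotheses (hfs : is_density Fs fs) (hfb : is_density Fb fb).
Local Notation e := (ess_inf lebesgue_measure (quotient01 fs fb)).

Lemma le_ess_inf_quotient01 c : c <= 1 ->
  (c%:E <= e)%E <-> \forall x \ae lebesgue_measure, c * fb x <= fs x.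
Proof.
move=> c1; have [_ fs0 _] := hfs; have [_ fb0 _] := hfb.
rewrite -(rwP ess_infP).
by split; apply: filterS => x; rewrite le_quotient01.
Qed.

(** The nondecreasing function [Fs - c * Fb] has limit 0 at -oo and [1 - c] at +oo; both are
    compared with its value at 0. *)
Lemma density_ratio_le1 c :
  (\forall x \ae lebesgue_measure, c * fb x <= fs x) -> c <= 1.
Proof.
move/(nondecreasing_density c hfs hfb) => nd.
have [_ _ s0 s1] := hFs; have [_ _ b0 b1] := hFb.
suff : 0 - c * 0 <= 1 - c * 1 by rewrite mulr0 mulr1 subrr subr_ge0.
have l0 : Fs x - c * Fb x @[x --> -oo] --> 0 - c * 0.
  by apply: cvgB => //; exact: cvgMl_tmp.
have l1 : Fs x - c * Fb x @[x --> +oo] --> 1 - c * 1.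
  by apply: cvgB => //; exact: cvgMl_tmp.
apply: (@le_trans _ _ (Fs 0 - c * Fb 0)).
  apply: cvgr_to_le l0 _; apply: filterS (nbhs_ninfty_le (num_real 0)) => x.
  exact: nd.
apply: cvgr_to_ge l1 _; apply: filterS (nbhs_pinfty_ge (num_real 0)) => x.
exact: nd.
Qed.

(** An essential infimum above 1 would yield a real [c > 1] with [c * fb <= fs] almost everywhere,
    against [density_ratio_le1]. Only [quotient01_ge_mul] is available for such [c], and it
    suffices. *)
Lemma ess_inf_quotient01_itv : (0 <= e <= 1)%E.
Proof.
have [_ fs0 _] := hfs; have [_ fb0 _] := hfb.
apply/andP; split.
  by apply/le_ess_inf_quotient01 => //; apply: nearW => x; rewrite mul0r.
rewrite leNgt; apply/negP => e1.
have [c c1 ce] : exists2 c : R, 1 < c & (c%:E <= e)%E.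
  case: e e1 => [r|_|//]; first by rewrite lte_fin; exists r.
  by exists 2; rewrite ?ltr1n ?leey.
have : \forall x \ae lebesgue_measure, c * fb x <= fs x.
  move/ess_infP: ce; apply: filterS => x.
  exact: quotient01_ge_mul.
by move/density_ratio_le1; rewrite leNgt c1.
Qed.

Lemma is_cdf_affine a : 0 <= a ->
  is_cdf (fun x => a * Fs x + (1 - a) * Fb x) <->
  a * (1 - fine e) <= 1.
Proof.
move=> a0; have /andP[e0 e1] := ess_inf_quotient01_itv.
have eE : e = (fine e)%:E by rewrite fineK// ge0_fin_numE// (le_lt_trans e1)// ltry.
have [ndFs rcs s0 s1] := hFs; have [ndFb rcb b0 b1] := hFb.
(* The weights sum to 1, so right continuity and both limits are inherited; only monotonicity is at
   stake, as [1 - a] may be negative. *)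
have -> : is_cdf (fun x => a * Fs x + (1 - a) * Fb x) <->
    nondecreasing (fun x => a * Fs x + (1 - a) * Fb x).
  split=> [[]//|nd]; split => //.
  - by move=> x; apply: cvgD; exact: cvgMl_tmp.
  - rewrite [X in _ --> X](_ : 0 = a * 0 + (1 - a) * 0 :> R); last by ring.
    by apply: cvgD; exact: cvgMl_tmp.
  - rewrite [X in _ --> X](_ : 1 = a * 1 + (1 - a) * 1 :> R); last by ring.
    by apply: cvgD; exact: cvgMl_tmp.
(* For [a = 0] the function is [Fb]; otherwise [a] is factored out, leaving
   [Fs - (1 - a^-1) * Fb]. *)
have [->|aN0] := eqVneq a 0.
  split=> _; first by rewrite mul0r ler01.
  by move=> x y xy; rewrite !mul0r !add0r subr0 !mul1r ndFb.
have {aN0} a_gt0 : 0 < a by rewrite lt_neqAle eq_sym aN0.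
have ca : 1 - a^-1 <= 1 by rewrite gerBl invr_ge0 ltW.
have -> : a * (1 - fine e) <= 1 <-> ((1 - a^-1)%:E <= e)%E.
  by rewrite eE lee_fin lerBlDr -lerBlDl -ler_pdivlMl// mulr1.
rewrite le_ess_inf_quotient01// -(nondecreasing_density _ hfs hfb).
have E x : a * Fs x + (1 - a) * Fb x = a * (Fs x - (1 - a^-1) * Fb x).
  by field; exact: lt0r_neq0.
split=> nd x y xy.
  by have := nd x y xy; rewrite !E ler_pM2l.
by rewrite !E ler_pM2l// nd.
Qed.

End density.

Theorem lemma4 (R : realType) (alpha : R) (Fs Fb fs fb : R -> R)
  (halpha : 0 <= alpha <= 1)
  (hFs : is_cdf Fs) (hFb : is_cdf Fb)
  (hfs : is_density Fs fs) (hfb : is_density Fb fb)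
  (hne : Fs <> Fb) :
  let F : R -> R := fun x => alpha * Fs x + (1 - alpha) * Fb x in
  ((alpha0 F Fb)%:E =
     alpha%:E * (1 - ess_inf lebesgue_measure (quotient01 fs fb)))%E
  /\ (0 < alpha ->
      (alpha0 F Fb < alpha <->
       exists c : R, 0 < c /\
         \forall x \ae lebesgue_measure, c * fb x <= fs x)).
Proof.
move=> F; have /andP[al0 al1] := halpha.
have /andP[e0 e1] := ess_inf_quotient01_itv hFs hFb hfs hfb.
have cdfE := is_cdf_affine hFs hFb hfs hfb.
have infP c := le_ess_inf_quotient01 hfs hfb (c := c).
have eE : ess_inf lebesgue_measure (quotient01 fs fb) =
    (fine (ess_inf lebesgue_measure (quotient01 fs fb)))%:E.
  by rewrite fineK// ge0_fin_numE// (le_lt_trans e1)// ltry.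
move: (fine _) eE cdfE => e eE cdfE.
rewrite eE !lee_fin in e0 e1 infP *.
set m := alpha * (1 - e).
have m0 : 0 <= m by rewrite mulr_ge0// subr_ge0.
have m1 : m <= 1 by rewrite mulr_ile1// ?subr_ge0// gerBl.
have alpha0E : alpha0 F Fb = m.
  have : alpha0 F Fb = inf [set g | 0 < g <= 1 /\ m <= g].
    congr inf; apply/seteqP; split=> g /= [/andP[g0 g1]];
      have -> : (fun x => (F x - (1 - g) * Fb x) / g) =
          (fun x => alpha / g * Fs x + (1 - alpha / g) * Fb x)
        by apply/funext => x; rewrite /F; field; exact: lt0r_neq0.
    - move/cdfE; rewrite divr_ge0 ?(ltW g0)// => /(_ isT).
      by rewrite mulrAC ler_pdivrMr// mul1r g0.
    - move=> mg; split; first by rewrite g0.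
      by apply/cdfE; [rewrite divr_ge0 ?(ltW g0)|rewrite mulrAC ler_pdivrMr// mul1r].
  (* If [m = 0], the bound [m <= g] is vacuous and the set is []0, 1]]; if [m > 0], it is [[m, 1]].
     Both have infimum [m]. *)
  move=> ->; move: m0; rewrite le_eqVlt => /predU1P[m0|m0].
    rewrite -m0 -[RHS](@inf_itv _ (BRight 1) false 0) ?bnd_simp//.
    congr inf; apply/seteqP; split=> g /=; rewrite in_itv/=; first by case.
    by move=> g01; split=> //; case/andP: g01 => /ltW.
  rewrite -[RHS](@inf_itv _ (BRight 1) true m) ?bnd_simp//.
  congr inf; apply/seteqP; split=> g /=; rewrite in_itv/=.
    by move=> [/andP[_ ->] ->].
  by move=> /andP[mg ->]; rewrite (lt_le_trans m0 mg).
rewrite alpha0E; split; first by rewrite -EFinB -EFinM.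
move=> al_gt0; have -> : (m < alpha) = (0 < e).
  by rewrite /m mulrBr mulr1 gtrBl pmulr_rgt0.
(* The essential infimum [e] is itself a valid constant. Conversely, any valid [c] is at most 1, so
   [infP] applies and gives [0 < c <= e]. *)
split=> [e_gt0|[c [c0 cP]]]; first by exists e; split=> //; exact/infP.
have c1 := density_ratio_le1 hFs hFb hfs hfb cP.
by rewrite (lt_le_trans c0)//; move: (infP c c1).2; rewrite lee_fin; exact.
Qed.
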